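(* Any IET that is reversible in $\mathcal G$ can be written as a product of $2$ periodic elements of $\mathcal G$.
   Context: An interval exchange transformation (IET) is a bijection of $[0,1)$ defined by a finite partition of $[0,1)$ into half-open subintervals and a reordering of these intervals by translations; $\mathcal G$ is the group of all IETs. $f\in\mathcal G$ is reversible in $\mathcal G$ if there is $h\in\mathcal G$ with $hfh^{-1}=f^{-1}$. An element of $\mathcal G$ is periodic if it has finite order. *)

(* Defs.v *)
From HB Require Import structures.
From mathcomp Require Import all_boot all_order all_algebra.
From mathcomp Require Import boolp classical_sets set_interval reals.

Set Implicit Arguments.
Unset Strict Implicit.
Unset Printing Implicit Defensive.

Import Order.TTheory GRing.Theory Num.Theory.
Local Open Scope ring_scope.

Definition unit_co (R : realType) : Type := {x : R | 0 <= x < 1}.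

(* The translated intervals [a i + c i, b i + c i) again partition [0, 1),
   because f is a bijection of [0, 1).  Half-open intervals that partition
   [0, 1) are necessarily closed on the left. *)
Definition is_iet (R : realType) (f : unit_co R -> unit_co R) : Prop :=
  bijective f /\
  exists (n : nat) (a b c : 'I_n -> R),
    partition [set: 'I_n] (fun i => `[a i, b i[%classic) `[0, 1[%classic /\
    forall (i : 'I_n) (x : unit_co R),
      a i <= val x < b i -> val (f x) = val x + c i.

Record iet (R : realType) : Type := Iet {
  iet_fun :> unit_co R -> unit_co R;
  iet_funP : is_iet iet_fun
}.

Section IetGroup.
Variable R : realType.
Implicit Types f g h : iet R.

Lemma iet_eqP f g : f =1 g -> f = g.
Proof.
case: f g => [f fP] [g gP] /= /funext fg.
by case: _ / fg gP => gP; rewrite (Prop_irrelevance fP gP).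
Qed.

Lemma iet_bij f : bijective f. Proof. by case: (iet_funP f). Qed.

Lemma is_iet_fin (f : unit_co R -> unit_co R) (T : finType) (a b c : T -> R) :
    bijective f ->
    (forall i (y : R), a i <= y < b i -> 0 <= y < 1) ->
    (forall x : unit_co R, exists i, a i <= val x < b i) ->
    (forall i j (x : unit_co R), a i <= val x < b i ->
       a j <= val x < b j -> i = j) ->
    (forall i (x : unit_co R), a i <= val x < b i -> val (f x) = val x + c i) ->
  is_iet f.
Proof.
move=> fB sub cov disj tr; split => //.
pose S := {i : T | a i < b i}.
pose F (k : 'I_#|{: S}|) : T := val (enum_val k).
have FI : injective F by move=> k l /val_inj /enum_val_inj.
have FE i : a i < b i -> exists k, F k = i.
  by move=> ab; exists (enum_rank (exist _ i ab : S)); rewrite /F enum_rankK.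
exists #|{: S}|, (a \o F), (b \o F), (c \o F); split; last first.
  by move=> i x; exact: tr.
split.
- apply/seteqP; split => [y [k _] /=|y /=]; rewrite !in_itv /=.
    exact: sub.
  move=> y01; have [i xi] := cov (exist _ y y01).
  have [|k Fk] := FE i; first by case/andP: xi; exact: le_lt_trans.
  by exists k => //=; rewrite in_itv /= Fk.
- move=> k l _ _ [y [/=]]; rewrite !in_itv /= => yk yl; apply: FI.
  exact: (disj _ _ (exist _ y (sub _ _ yk))).
- move=> k _; exists (a (F k)); rewrite /= in_itv /= lexx /=.
  exact: (valP (enum_val k)).
Qed.

Lemma is_iet_pieces (f : unit_co R -> unit_co R) : is_iet f ->
  exists (n : nat) (a b c : 'I_n -> R), [/\
    forall i (y : R), a i <= y < b i -> 0 <= y < 1,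
    forall x : unit_co R, exists i, a i <= val x < b i,
    forall i j (x : unit_co R), a i <= val x < b i ->
       a j <= val x < b j -> i = j &
    forall i (x : unit_co R), a i <= val x < b i -> val (f x) = val x + c i].
Proof.
move=> [_ [n [a [b [c [[cov triv _] tr]]]]]]; exists n, a, b, c; split => //.
- move=> i y yi.
  have : `[0%R, 1%R[%classic y.
    by rewrite -cov; exists i => //=; rewrite in_itv.
  by rewrite /= in_itv.
- move=> x; have : `[0%R, 1%R[%classic (val x).
    by rewrite /= in_itv /=; exact: valP x.
  by rewrite -cov => -[i _ /=]; rewrite in_itv /=; exists i.
- move=> i j x xi xj; apply: triv => //; exists (val x).
  by rewrite /= !in_itv.
Qed.

Lemma is_iet_id : is_iet (@id (unit_co R)).
Proof.
apply: (@is_iet_fin _ unit (fun=> 0) (fun=> 1) (fun=> 0)) => //.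
- by exists id.
- by move=> x; exists tt; exact: valP x.
- by case; case.
- by move=> _ x _; rewrite addr0.
Qed.

Lemma is_iet_comp f g : is_iet (f \o g).
Proof.
have [n [a [b [c [sub cov disj tr]]]]] := is_iet_pieces (iet_funP f).
have [m [a' [b' [c' [sub' cov' disj' tr']]]]] := is_iet_pieces (iet_funP g).
have P (y : R) (k : 'I_n * 'I_m) :
    (Num.max (a' k.2) (a k.1 - c' k.2) <= y <
     Num.min (b' k.2) (b k.1 - c' k.2)) =
    (a' k.2 <= y < b' k.2) && (a k.1 <= y + c' k.2 < b k.1).
  by rewrite ge_max lt_min lerBlDr ltrBrDr andbACA.
have Q (x : unit_co R) (k : 'I_n * 'I_m) :
    (Num.max (a' k.2) (a k.1 - c' k.2) <= val x <
     Num.min (b' k.2) (b k.1 - c' k.2)) ->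
    (a' k.2 <= val x < b' k.2) /\ (a k.1 <= val (g x) < b k.1).
  by rewrite P => /andP[xk]; rewrite (tr' _ _ xk).
apply: (@is_iet_fin _ ('I_n * 'I_m)%type
          (fun k => Num.max (a' k.2) (a k.1 - c' k.2))
          (fun k => Num.min (b' k.2) (b k.1 - c' k.2))
          (fun k => c k.1 + c' k.2)).
- by apply: bij_comp; exact: iet_bij.
- by move=> k y; rewrite P => /andP[/sub'].
- move=> x; have [j xj] := cov' x; have [i xi] := cov (g x).
  by exists (i, j); rewrite P /= xj -(tr' _ _ xj).
- move=> [i j] [k l] x /(Q x (i, j)) /= [h1 h2] /(Q x (k, l)) /= [h3 h4].
  by rewrite (disj' _ _ _ h1 h3) (disj _ _ _ h2 h4).
- move=> k x /(Q x k) [h1 h2] /=; rewrite (tr _ _ h2) (tr' _ _ h1).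
  by rewrite -addrA [c' _ + _]addrC.
Qed.

Lemma is_iet_inv f (g : unit_co R -> unit_co R) :
  cancel f g -> cancel g f -> is_iet g.
Proof.
move=> fg gf.
have [n [a [b [c [sub cov disj tr]]]]] := is_iet_pieces (iet_funP f).
have P (y : R) i : (a i + c i <= y < b i + c i) = (a i <= y - c i < b i).
  by rewrite lerBrDr ltrBlDr.
have E i (y : R) (yi : a i <= y - c i < b i) :
    val (f (exist (fun z : R => is_true (0 <= z < 1)) _ (sub _ _ yi))) = y.
  by rewrite (tr i) //= subrK.
have Q i (x : unit_co R) : a i + c i <= val x < b i + c i ->
    a i <= val (g x) < b i /\ val (g x) = val x - c i.
  rewrite P => xi; have /val_inj <- := E _ _ xi.
  by rewrite fg (tr i) //= addrK.
apply: (@is_iet_fin _ _ (fun i => a i + c i) (fun i => b i + c i)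
                        (fun i => - c i)).
- by exists f.
- by move=> i y; rewrite P => yi; rewrite -(E _ _ yi); exact: valP (f _).
- move=> x; have [i xi] := cov (g x); exists i.
  by rewrite -[x in val x]gf (tr _ _ xi) lerD2r ltrD2r.
- by move=> i j x /Q[xi _] /Q[xj _]; exact: disj xi xj.
- by move=> i x /Q[].
Qed.

Lemma iet_inv_ex f : exists g : iet R, cancel f g /\ cancel g f.
Proof. by case: (iet_bij f) => g fg gf; exists (Iet (is_iet_inv fg gf)). Qed.

Definition iet_one : iet R := Iet is_iet_id.
Definition iet_mul f g : iet R := Iet (is_iet_comp f g).
Definition iet_inv f : iet R := projT1 (cid (iet_inv_ex f)).

Lemma iet_invK f : cancel f (iet_inv f).
Proof. by rewrite /iet_inv; case: cid => g []. Qed.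

Lemma iet_invVK f : cancel (iet_inv f) f.
Proof. by rewrite /iet_inv; case: cid => g []. Qed.

Lemma iet_mulA : associative iet_mul.
Proof. by move=> f g h; exact: iet_eqP. Qed.

Lemma iet_mul1 : left_id iet_one iet_mul.
Proof. by move=> f; exact: iet_eqP. Qed.

Lemma iet_mulr1 : right_id iet_one iet_mul.
Proof. by move=> f; exact: iet_eqP. Qed.

Lemma iet_mulV : left_inverse iet_one iet_inv iet_mul.
Proof. by move=> f; apply: iet_eqP => x /=; rewrite iet_invK. Qed.

Lemma iet_mulrV : right_inverse iet_one iet_inv iet_mul.
Proof. by move=> f; apply: iet_eqP => x /=; rewrite iet_invVK. Qed.

HB.instance Definition _ := gen_eqMixin (iet R).
HB.instance Definition _ := gen_choiceMixin (iet R).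
HB.instance Definition _ := isGroup.Build (iet R)
  iet_mulA iet_mul1 iet_mulr1 iet_mulV iet_mulrV.

Lemma iet_mulE f g x : (f * g)%g x = f (g x). Proof. by []. Qed.

Lemma iet_oneE x : (1%g : iet R) x = x. Proof. by []. Qed.

End IetGroup.

Definition reversible (G : groupType) (f : G) : Prop :=
  exists h : G, (h * f * h^-1 = f^-1)%g.

Definition periodic (G : groupType) (f : G) : Prop :=
  exists2 n : nat, (0 < n)%N & (f ^+ n = 1)%g.

(* Main.v *)
Require Import Defs.
From mathcomp Require Import all_boot reals.
From mathcomp Require Import all_order all_algebra boolp.
From mathcomp Require Import lra zify.

(* If [k] has finite order and [k f k^-1 = f^-1], then [(k f)^2 = k^2], so
   [f = k^-1 (k f)] is a product of two periodic elements; it suffices to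
   replace the given reverser [h] by one of finite order.  Put [g = h^2], which
   commutes with [f].

   On the periodic points of [f] reflect each orbit about its least element.
   Elsewhere, the [f]-invariant finite unions of intervals have their endpoints
   in a fixed finite set, so there is a maximal [f]- and [g]-invariant [B] with
   [h B] disjoint from [B]; use [h] on [B] and [h^-1] on [h B].  On what
   remains, [h] itself has finite order: if [g^k x = f^n x] with [n <> 0], the
   set of all such [x] could be added to [B]; so suppose that [f] and [g]
   generate a free action of Z^2.

   There, gluing the left germ at [v] to the right germ at [x] when their images
   under [g^k] are adjacent for all large [k] changes the usual gluing at
   finitely many points only, because an [f]-orbit meets few discontinuities.
   Both [f] and [h] respect this gluing, hence commute with the translation
   [psi] by a small [-delta] along it.  By the pigeonhole principle
   [f^i x = psi (f^j x)] for some [delta > 0] and [i <> j]; the set of such [x]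
   could again be added to [B], as [h] exchanges [f] and [f^-1] but commutes
   with [psi]. *)

Set Implicit Arguments.
Unset Strict Implicit.
Unset Printing Implicit Defensive.

Import Order.TTheory GRing.Theory Num.Theory.
Local Open Scope ring_scope.

(** * Piecewise translations of the real line *)

Section PiecewiseTranslations.
Variable R : realType.
Implicit Types (x y : R) (D : seq R) (f g h : iet R) (S T : R -> Prop).

Lemma seq_argmin (T : eqType) (F : T -> R) (P : pred T) (s : seq T) t0 :
    t0 \in s -> P t0 ->
  exists2 t, t \in s /\ P t & forall u, u \in s -> P u -> F t <= F u.
Proof.
elim: s t0 => [//|a s IH] t0; rewrite inE => /orP t0s Pt0.
have [[v vs Pv]|nv] := pselect (exists2 v, v \in s & P v).
  have [t [ts Pt] tmin] := IH v vs Pv.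
  have [Pa|nPa] := boolP (P a); last first.
    exists t; first by rewrite inE ts orbT.
    move=> u; rewrite inE => /predU1P[->|us] Pu; first by case/negP: nPa.
    exact: tmin.
  have [le_at|/ltW le_ta] := leP (F a) (F t).
    exists a; first by rewrite mem_head.
    move=> u; rewrite inE => /predU1P[->//|us] Pu.
    exact: le_trans le_at (tmin u us Pu).
  exists t; first by rewrite inE ts orbT.
  by move=> u; rewrite inE => /predU1P[->//|us] Pu; exact: tmin.
exists a.
  rewrite mem_head; split=> //.
  by case: t0s => [/eqP <-//|t0s]; case: nv; exists t0.
by move=> u; rewrite inE => /predU1P[->//|us] Pu; case: nv; exists u.
Qed.

Lemma seq_max (P : pred R) (s : seq R) x0 : x0 \in s -> P x0 ->
  exists2 m, m \in s /\ P m & forall u, u \in s -> P u -> u <= m.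
Proof.
move=> x0s Px0; have [m ms mmin] := seq_argmin (fun u : R => - u) x0s Px0.
by exists m => // u us Pu; rewrite -lerN2 mmin.
Qed.

(* [D] misses the interval open at [x] and closed at [y]: as pieces are closed
   on the left, [x] and [y] then lie in the same piece even if [x] is in [D]. *)
Definition gap D x y := forall d, d \in D -> ~~ (x < d <= y).

Definition elementary S :=
  exists D, forall x y, x <= y -> gap D x y -> S x <-> S y.

Definition translates_on D (F : R -> R) :=
  forall x y, x <= y -> gap D x y -> F y = F x + (y - x).

Definition piecewise_translation F := exists D, translates_on D F.

Lemma gap_cat D E x y : gap (D ++ E) x y <-> gap D x y /\ gap E x y.
Proof.
split=> [H|[H1 H2] d].
  by split=> d dD; apply: H; rewrite mem_cat dD ?orbT.
by rewrite mem_cat => /orP[]; [exact: H1|exact: H2].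
Qed.

Lemma gap_sub D x y x' y' : x <= x' -> y' <= y -> gap D x y -> gap D x' y'.
Proof.
move=> xx yy H d dD; apply: contra (H d dD) => /andP[x'd dy'].
by rewrite (le_lt_trans xx x'd) (le_trans dy' yy).
Qed.

Lemma gapP D x y : gap D x y \/ exists2 d, d \in D & x < d <= y.
Proof.
have [|nH] := pselect (exists2 d, d \in D & x < d <= y); first by right.
by left=> d dD; apply/negP => xdy; apply: nH; exists d.
Qed.

Lemma elementary_not S : elementary S -> elementary (fun x => ~ S x).
Proof. by move=> [D H]; exists D => x y xy gxy; rewrite (H x y). Qed.

Lemma elementary_and S T : elementary S -> elementary T ->
  elementary (fun x => S x /\ T x).
Proof.
move=> [D HS] [E HT]; exists (D ++ E) => x y xy /gap_cat[gD gE].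
by rewrite (HS x y) // (HT x y).
Qed.

Lemma elementary_or S T : elementary S -> elementary T ->
  elementary (fun x => S x \/ T x).
Proof.
move=> [D HS] [E HT]; exists (D ++ E) => x y xy /gap_cat[gD gE].
by rewrite (HS x y) // (HT x y).
Qed.

Lemma elementary_const (P : Prop) : elementary (fun=> P).
Proof. by exists [::]. Qed.

Lemma elementary_eq F G : piecewise_translation F -> piecewise_translation G ->
  elementary (fun x => F x = G x).
Proof.
move=> [D HF] [E HG]; exists (D ++ E) => x y xy /gap_cat[gD gE].
by rewrite (HF x y) // (HG x y) //; split=> [->|/addIr].
Qed.

Lemma elementary_le F G : piecewise_translation F -> piecewise_translation G ->
  elementary (fun x => F x <= G x).
Proof.
move=> [D HF] [E HG]; exists (D ++ E) => x y xy /gap_cat[gD gE].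
by rewrite (HF x y) // (HG x y) // lerD2r.
Qed.

Lemma elementary_forall n (S_ : nat -> R -> Prop) :
  (forall i, elementary (S_ i)) ->
  elementary (fun x => forall i, (i < n)%N -> S_ i x).
Proof.
move=> HS; elim: n => [|n [D IH]]; first by exists [::].
have [E HE] := HS n; exists (D ++ E) => x y xy /gap_cat[gD gE].
have [IHl IHr] := IH x y xy gD; have [HEl HEr] := HE x y xy gE.
split=> H i; rewrite ltnS leq_eqVlt => /predU1P[->|i_lt].
- by apply: HEl; exact: H.
- by apply: IHl i_lt => j jn; apply: H; rewrite ltnW.
- by apply: HEr; exact: H.
- by apply: IHr i_lt => j jn; apply: H; rewrite ltnW.
Qed.

Lemma elementary_ext S T : (forall x, S x <-> T x) -> elementary S ->
  elementary T.
Proof. by move=> ST [D H]; exists D => x y xy gxy; rewrite -!ST; exact: H. Qed.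

Lemma piecewise_translation_if (b : R -> bool) F G : elementary b ->
    piecewise_translation F -> piecewise_translation G ->
  piecewise_translation (fun x => if b x then F x else G x).
Proof.
move=> [C Hb] [D HF] [E HG].
exists (C ++ (D ++ E)) => x y xy /gap_cat[gC /gap_cat[gD gE]].
have -> : b y = b x by apply/idP/idP => H; apply/(Hb x y).
by case: (b x); [exact: HF|exact: HG].
Qed.

(* Extending by the identity to all of [R] gives every point, 0 included, a
   left germ. *)
Definition act f x : R :=
  if insub x is Some u then val (f (u : unit_co R)) else x.

Lemma actE f (u : unit_co R) : act f (val u) = val (f u).
Proof. by rewrite /act valK. Qed.

Lemma act_out f x : ~~ (0 <= x < 1) -> act f x = x.
Proof. by move=> xout; rewrite /act insubN. Qed.

Lemma act_mul f g x : act (f * g)%g x = act f (act g x).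
Proof.
have [x01|xout] := boolP (0 <= x < 1); last by rewrite !act_out.
by rewrite -[x]/(val (exist _ x x01 : unit_co R)) !actE.
Qed.

Lemma act1 x : act 1%g x = x.
Proof.
have [x01|xout] := boolP (0 <= x < 1); last by rewrite !act_out.
by rewrite -[x]/(val (exist _ x x01 : unit_co R)) !actE.
Qed.

Lemma act_eqP f g : act f =1 act g -> f = g.
Proof.
by move=> fg; apply: iet_eqP => u; apply: val_inj; rewrite -!actE fg.
Qed.

Lemma actK f : cancel (act f) (act f^-1%g).
Proof. by move=> x; rewrite -act_mul mulVg act1. Qed.

Lemma actVK f : cancel (act f^-1%g) (act f).
Proof. by move=> x; rewrite -act_mul mulgV act1. Qed.

Lemma act_inj f : injective (act f).
Proof. exact: can_inj (actK f). Qed.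

Lemma act_piecewise f : piecewise_translation (act f).
Proof.
have [n [a [b [c [sub cov disj tr]]]]] := is_iet_pieces (iet_funP f).
(* Left endpoints suffice: the piece that holds [y] starts at or before [x], hence holds [x] too. *)
exists [:: 0, 1 & codom a] => x y xy H.
have H0 : ~~ (x < 0 <= y) by apply: H; rewrite !inE eqxx.
have H1 : ~~ (x < 1 <= y) by apply: H; rewrite !inE eqxx orbT.
have Ha i : ~~ (x < a i <= y) by apply: H; rewrite !inE codom_f !orbT.
have [x01|xout] := boolP (0 <= x < 1); last first.
  by rewrite !act_out //; lra.
have y01 : 0 <= y < 1 by lra.
pose u : unit_co R := exist _ x x01; pose v : unit_co R := exist _ y y01.
have [i ui] := cov u; have [j vj] := cov v.
have uj : a j <= val u < b j by have /= := Ha j; rewrite /= in vj *; lra.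
rewrite (actE f u) (actE f v) (tr _ _ uj) (tr _ _ vj) /=; lra.
Qed.

Lemma elementary_act f S : elementary S -> elementary (fun x => S (act f x)).
Proof.
move=> [D HS]; have [E HE] := act_piecewise f.
exists (E ++ map (act f^-1%g) D) => x y xy /gap_cat[gE gD].
apply: HS => [|d dD]; first by rewrite (HE x y) // lerDl subr_ge0.
apply/negP => /andP[]; rewrite (HE x y) // => lt_d le_d.
pose e := x + (d - act f x).
have fe : act f e = d.
  rewrite (HE x e); last by apply: gap_sub gE; rewrite /e; lra.
    by rewrite /e; lra.
  by rewrite /e; lra.
have := gD _ (map_f _ dD); rewrite -fe actK /e; lra.
Qed.

Lemma iet_of_piecewise F G : cancel F G -> cancel G F ->
    (forall x, ~~ (0 <= x < 1) -> F x = x) -> piecewise_translation F ->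
  exists k : iet R, forall x, act k x = F x.
Proof.
move=> FG GF Fout [D HF].
have Gout x : ~~ (0 <= x < 1) -> G x = x by move=> /Fout Fx; rewrite -{1}Fx FG.
have Fin x : 0 <= x < 1 -> 0 <= F x < 1.
  by apply: contraLR => Fx; rewrite -(can_inj FG (Fout _ Fx)).
have Gin x : 0 <= x < 1 -> 0 <= G x < 1.
  by apply: contraLR => Gx; rewrite -(can_inj GF (Gout _ Gx)).
pose Fu (u : unit_co R) : unit_co R :=
  exist (fun z : R => is_true (0 <= z < 1)) _ (Fin _ (valP u)).
pose Gu (u : unit_co R) : unit_co R :=
  exist (fun z : R => is_true (0 <= z < 1)) _ (Gin _ (valP u)).
(* Pieces start at 0 and at the breakpoints in [0, 1); [b i] is the next start, or 1 after the
   last. *)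
pose E : seq R := [seq d <- 0 :: D | 0 <= d < 1].
pose b (i : R) : R := \big[Order.min/1]_(d <- E | i < d) d.
have ltb (i y : R) : y < b i <-> y < 1 /\ forall d, d \in E -> i < d -> y < d.
  rewrite /b; elim: (E) => [|e s IH].
    by rewrite big_nil; split=> [|[]].
  rewrite big_cons; case: ifP => ie.
    rewrite lt_min; split=> [/andP[ye /IH[y1 H]]|[y1 H]].
      by split=> // d; rewrite inE => /predU1P[->//|]; exact: H.
    apply/andP; split; first by apply: H; rewrite ?mem_head.
    by apply/IH; split=> // d ds; apply: H; rewrite inE ds orbT.
  split=> [/IH[y1 H]|[y1 H]].
    by split=> // d; rewrite inE => /predU1P[->|]; [rewrite ie|exact: H].
  by apply/IH; split=> // d ds; apply: H; rewrite inE ds orbT.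
have Fiet : is_iet Fu.
  apply: (@is_iet_fin _ _ (seq_sub E) (fun i => ssval i) (fun i => b (ssval i))
            (fun i => F (ssval i) - ssval i)).
  - by exists Gu => u; apply: val_inj; rewrite /= ?FG ?GF.
  - move=> [i iE] y /= /andP[iy /ltb[y1 _]]; rewrite y1 andbT.
    by move: iE; rewrite mem_filter => /andP[/andP[i0 _] _]; exact: le_trans iy.
  - move=> [x x01] /=.
    have zE : 0 \in E by rewrite mem_filter inE eqxx lexx ltr01.
    have [|m [mE mx] mmax] := @seq_max (fun d => d <= x) E 0 zE.
      by case/andP: x01.
    exists (SeqSub mE) => /=; rewrite mx /=; apply/ltb.
    split; first by case/andP: x01.
    move=> d dE md; rewrite ltNge; apply/negP => /(mmax d dE).
    by rewrite leNgt md.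
  - move=> [i iE] [j jE] x /= /andP[ix /ltb[_ xi]] /andP[jx /ltb[_ xj]].
    apply: val_inj => /=; case: (ltgtP i j) => // ij.
      by move: (xi _ jE ij); rewrite ltNge jx.
    by move: (xj _ iE ij); rewrite ltNge ix.
  - move=> [i iE] x /= /andP[ix /ltb[x1 xi]].
    rewrite (HF i (val x)) //; last first.
      move=> d dD; apply/negP => /andP[id dx].
      suff /xi/(_ id) : d \in E by rewrite ltNge dx.
      rewrite mem_filter inE dD orbT andbT (le_lt_trans dx x1) andbT.
      move: iE; rewrite mem_filter => /andP[/andP[i0 _] _].
      exact: le_trans i0 (ltW id).
    by rewrite addrCA.
exists (Iet Fiet) => x; have [x01|xout] := boolP (0 <= x < 1); last first.
  by rewrite act_out // Fout.
by rewrite -[x]/(val (exist _ x x01 : unit_co R)) actE.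
Qed.

End PiecewiseTranslations.

(** * Sequences and finite sets *)

Section Sequences.

Lemma pigeonhole (T : eqType) (s : seq T) (u : nat -> T) :
  (forall n, u n \in s) -> exists i j, (i < j)%N /\ u i = u j.
Proof.
move=> us; apply: contrapT => nex.
have inj_u : injective u.
  move=> i j uij; case: (ltngtP i j) => // ij; case: nex.
    by exists i, j.
  by exists j, i.
suff: (size (mkseq u (size s).+1) <= size s)%N by rewrite size_mkseq ltnn.
apply: uniq_leq_size; first exact: mkseq_uniq.
by move=> _ /mapP[i _ ->].
Qed.

Lemma injective_leaves (T : eqType) (s : seq T) (u : nat -> T) :
  injective u -> exists n0, forall n, (n0 <= n)%N -> u n \notin s.
Proof.
move=> inj_u; elim: s => [|a s [n0 IH]]; first by exists 0%N.
have [[i ui]|na] := pselect (exists i, u i = a); last first.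
  exists n0 => n /IH us; rewrite inE negb_or us andbT.
  by apply/eqP => una; apply: na; exists n.
exists (maxn n0 i.+1) => n; rewrite geq_max inE => /andP[/IH us i_lt].
by rewrite negb_or us andbT -ui (inj_eq inj_u) gtn_eqF.
Qed.

Lemma count_lt (T : eqType) (a b : pred T) (s : seq T) x :
    subpred a b -> x \in s -> b x -> ~~ a x ->
  (count a s < count b s)%N.
Proof.
move=> ab; elim: s => //= y s IH; rewrite inE => /predU1P[<-|xs] bx ax.
  by rewrite bx (negbTE ax) add0n add1n ltnS; exact: sub_count.
rewrite -addnS; apply: leq_add (IH xs bx ax).
by case ay: (a y) => //; rewrite (ab _ ay).
Qed.

End Sequences.

(** * Periodic orbits *)

Section Periods.
Variable R : realType.
Implicit Types (x y : R) (D : seq R) (f g h : iet R) (S : R -> Prop).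

Lemma actS f n x : act (f ^+ n.+1)%g x = act f (act (f ^+ n)%g x).
Proof. by rewrite expgS act_mul. Qed.

Lemma actD f m n x :
  act (f ^+ (m + n))%g x = act (f ^+ m)%g (act (f ^+ n)%g x).
Proof. by rewrite expgnDr act_mul. Qed.

Lemma act_commute f g x : commute f g -> act f (act g x) = act g (act f x).
Proof. by move=> fg; rewrite -!act_mul fg. Qed.

Lemma actXC f m n x :
  act (f ^+ m)%g (act (f ^+ n)%g x) = act (f ^+ n)%g (act (f ^+ m)%g x).
Proof. by rewrite -!actD addnC. Qed.

Lemma actNXK f n : cancel (act (f ^+ n)%g) (act (f^-1 ^+ n)%g).
Proof. by move=> x; rewrite expVgn actK. Qed.

Lemma actNXVK f n : cancel (act (f^-1 ^+ n)%g) (act (f ^+ n)%g).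
Proof. by move=> x; rewrite expVgn actVK. Qed.

Lemma actNX_sub f m n x : (m <= n)%N ->
  act (f^-1 ^+ m)%g (act (f ^+ n)%g x) = act (f ^+ (n - m))%g x.
Proof. by move=> mn; rewrite -{1}(subnKC mn) actD actNXK. Qed.

Definition per f x := exists2 p : nat, (0 < p)%N & act (f ^+ p)%g x = x.

Lemma act_mulnX f p q x : act (f ^+ p)%g x = x -> act (f ^+ (q * p))%g x = x.
Proof.
move=> fp; elim: q => [|q IH]; first by rewrite mul0n expg0 act1.
by rewrite mulSn actD IH.
Qed.

Lemma aper_in f x : ~ per f x -> 0 <= x < 1.
Proof.
by move=> nper; apply/negPn/negP => xout; apply: nper; exists 1%N => //;
  rewrite act_out.
Qed.

Lemma per_orbit f n x : per f (act (f ^+ n)%g x) <-> per f x.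
Proof.
split=> -[p p0 fp]; exists p => //; last by rewrite actXC fp.
by apply: (@act_inj _ (f ^+ n)%g); rewrite actXC.
Qed.

Lemma aper_inj f x : ~ per f x -> injective (fun n => act (f ^+ n)%g x).
Proof.
move=> nper; have main i j : (i < j)%N ->
    act (f ^+ i)%g x = act (f ^+ j)%g x -> False.
  move=> ij fij; apply: nper; exists (j - i)%N; first by rewrite subn_gt0.
  apply: (@act_inj _ (f ^+ i)%g).
  by rewrite -actD subnKC ?(ltnW ij).
by move=> i j fij; case: (ltngtP i j) => // /main []; rewrite fij.
Qed.

Lemma period_bound_seq f D :
  exists2 N : nat, (0 < N)%N &
  forall d, d \in D -> per f d -> act (f ^+ N)%g d = d.
Proof.
elim: D => [|a D [N N0 IH]]; first by exists 1%N.
have [[p p0 fp]|na] := pselect (per f a); last first.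
  exists N => // d; rewrite inE => /predU1P[->//|]; exact: IH.
exists (N * p)%N; first by rewrite muln_gt0 N0.
move=> d; rewrite inE => /predU1P[-> _|dD pd]; first exact: act_mulnX.
by rewrite mulnC; apply: act_mulnX; exact: IH.
Qed.

(* Sliding a periodic orbit to the left until one of its points meets a
   breakpoint [d] does not change its period. *)
Lemma period_bound f :
  exists2 N : nat, (0 < N)%N & forall x, per f x -> act (f ^+ N)%g x = x.
Proof.
have [D HD] := act_piecewise f.
(* With 0 added, every point of [0, 1) has a breakpoint at or to the left of it. *)
have [D0 D00 DD0] : exists2 D0 : seq R, 0 \in D0 & {subset D <= D0}.
  by exists (0 :: D) => [|d dD]; rewrite inE ?eqxx ?dD ?orbT.
have [N N0 HN] := period_bound_seq f D0.
exists N => // x [p p0 fp].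
have [x0|x0] := ltP x 0; first by rewrite act_out //; lra.
have [||] := @seq_argmin R _ (fun t : nat * R => act (f ^+ t.1)%g x - t.2)
  (fun t => t.2 <= act (f ^+ t.1)%g x)
  [seq (k, d) | k <- iota 0 p, d <- D0] (0%N, 0).
- by apply/allpairsP; exists (0%N, 0); rewrite mem_iota D00.
- by rewrite /= expg0 act1.
move=> [k d] [/allpairsP[[k' d'] /= [kp dD [? ?]]]]; subst k' d'.
set z := act (f ^+ k)%g x => /= dz dmin.
(* The orbits of [d] and [z] stay parallel: a breakpoint between them would be closer to an orbit
   point than [d] is to [z]. *)
have sh j : act (f ^+ j)%g d = act (f ^+ j)%g z - (z - d).
  elim: j => [|j IH]; first by rewrite expg0 !act1; lra.
  rewrite !actS IH; set w := act (f ^+ j)%g z.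
  rewrite (HD (w - (z - d)) w); [lra|lra|] => e eD.
  apply/negP => /andP[lte lee].
  have wE : w = act (f ^+ ((j + k) %% p))%g x.
    by rewrite /w /z -actD {1}(divn_eq (j + k) p) addnC actD (act_mulnX _ fp).
  have : z - d <= act (f ^+ ((j + k) %% p))%g x - e.
    apply: (dmin (((j + k) %% p)%N, e)); last by rewrite /= -wE.
    apply/allpairsP; exists (((j + k) %% p)%N, e).
    by rewrite mem_iota /= ltn_mod p0 DD0.
  by rewrite -wE; lra.
have fpz : act (f ^+ p)%g z = z by rewrite /z actXC fp.
have fNd : act (f ^+ N)%g d = d.
  by apply: HN => //; exists p => //; rewrite sh fpz; lra.
apply: (@act_inj _ (f ^+ k)%g); rewrite actXC -/z.
by have := sh N; rewrite fNd; lra.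
Qed.

(** With a uniform period [N], the periodic points are where f^N and the identity agree. *)
Lemma elementary_per f : elementary (per f).
Proof.
have [N N0 HN] := period_bound f.
apply: (@elementary_ext _ (fun x => act (f ^+ N)%g x = act 1%g x)) => [x|].
  by split=> [fN|/HN ->]; [exists N => //; rewrite fN act1|rewrite act1].
by apply: elementary_eq; exact: act_piecewise.
Qed.

(** Let [d] be the first point of [D] met from [x] onwards. Going back from [d], the previous visit
    to [D] occurs within [N] steps, with [N] uniform over [D], and [x] is passed before that
    visit. *)
Lemma orbit_segments_finite f D :
  exists E : seq R, forall x, (exists n, act (f ^+ n)%g x \in D) ->
    (exists m, act (f^-1 ^+ m.+1)%g x \in D) -> x \in E.
Proof.
have [N HN] : exists N : nat, forall d, d \in D ->
    (exists m, act (f^-1 ^+ m.+1)%g d \in D) ->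
    exists2 m, (m < N)%N & act (f^-1 ^+ m.+1)%g d \in D.
  elim: {1}D => [|a s [N IH]]; first by exists 0%N.
  have [[m Hm]|na] := pselect (exists m, act (f^-1 ^+ m.+1)%g a \in D).
    exists (maxn N m.+1) => d; rewrite inE => /predU1P[->|ds] Hd.
      by exists m => //; rewrite leq_max leqnn orbT.
    by have [i iN] := IH d ds Hd; exists i => //; rewrite leq_max iN.
  by exists N => d; rewrite inE => /predU1P[->//|]; exact: IH.
exists [seq act (f^-1 ^+ n)%g d | d <- D, n <- iota 0 N] => x.
move=> /ex_minnP[n nD nmin] [m mD]; set d := act (f ^+ n)%g x in nD.
apply/allpairsP; exists (d, n); rewrite /= nD mem_iota /= add0n actNXK.
split=> //; have [|i iN iD] := HN d nD.
  by exists (m + n)%N; rewrite -addSn actD actNXK.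
rewrite ltnNge; apply/negP => Nn.
have iltn : (i < n)%N by exact: leq_trans iN Nn.
move: iD; rewrite /d actNX_sub // => /nmin; rewrite leqNgt ltn_subrL.
by rewrite (leq_ltn_trans _ iltn).
Qed.

End Periods.

(** * Endpoints of invariant sets *)

Section InvariantSets.
Variable R : realType.
Implicit Types (x y : R) (D : seq R) (f g h : iet R) (S : R -> Prop).

(** Pieces are closed on the left, so a right germ is carried by its base point; only left germs
    need a neighbourhood. *)
Definition left_near (P : R -> Prop) :=
  exists2 eta : R, 0 < eta & forall t, 0 < t < eta -> P t.

Lemma left_nearI (P Q : R -> Prop) : left_near P -> left_near Q ->
  left_near (fun t => P t /\ Q t).
Proof.
move=> [a a0 HP] [b b0 HQ]; exists (Num.min a b); first by rewrite lt_min a0.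
move=> t /andP[t0]; rewrite lt_min => /andP[ta tb].
by split; [apply: HP; rewrite t0 ta|apply: HQ; rewrite t0 tb].
Qed.

Lemma left_nearW (P Q : R -> Prop) : (forall t, 0 < t -> P t -> Q t) ->
  left_near P -> left_near Q.
Proof.
by move=> PQ [a a0 HP]; exists a => // t /andP[t0 ta]; apply: PQ (HP t _);
  rewrite ?t0.
Qed.

Lemma left_near_ex (P : R -> Prop) : left_near P -> exists2 t, 0 < t & P t.
Proof. by move=> [a a0 HP]; exists (a / 2); [lra|apply: HP; lra]. Qed.

Lemma left_near_avoid D x :
  left_near (fun t => forall d, d \in D -> ~~ (x - t <= d < x)).
Proof.
elim: D => [|a D IH]; first by exists 1.
have near_a : left_near (fun t => ~~ (x - t <= a < x)).
  have [ax|xa] := ltP a x; last by exists 1 => // t _; lra.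
  by exists (x - a); [lra|move=> t; lra].
apply: left_nearW (left_nearI IH near_a) => t _ [Ht ta] d.
by rewrite inE => /predU1P[->//|]; exact: Ht.
Qed.

Lemma left_near_gap D x : x \notin D -> left_near (fun t => gap D (x - t) x).
Proof.
move=> xD; apply: left_nearW (left_near_avoid D x) => t _ Ht d dD.
have := Ht d dD; have : d != x by apply: contraNneq xD => <-.
by rewrite neq_lt; lra.
Qed.

Lemma left_near_translates D (F : R -> R) x : translates_on D F -> x \notin D ->
  left_near (fun t => F (x - t) = F x - t).
Proof.
move=> HF xD; apply: left_nearW (left_near_gap xD) => t t0 gt.
by rewrite (HF (x - t) x) //; lra.
Qed.

Lemma left_limit (F : R -> R) x : piecewise_translation F ->
  exists v, left_near (fun t => F (x - t) = v - t).
Proof.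
move=> [D HF]; have [eta eta0 Heta] := left_near_avoid D x.
exists (F (x - eta / 2) + eta / 2); exists eta => // t tt.
have [te|te] := leP t (eta / 2).
  rewrite (HF (x - eta / 2) (x - t)); [lra|lra|] => d dD.
  by have := Heta (eta / 2) _ d dD; lra.
rewrite (HF (x - t) (x - eta / 2)); [lra|lra|] => d dD.
by have := Heta t tt d dD; lra.
Qed.

(** For elementary [S], these are the endpoints of its intervals. *)
Definition jump S e := left_near (fun t => S (e - t) <-> ~ S e).

Lemma jump_breakpoint D S e :
  (forall x y, x <= y -> gap D x y -> S x <-> S y) -> jump S e -> e \in D.
Proof.
move=> HS je; apply/negPn/negP => eD.
have [t t0 [St gt]] := left_near_ex (left_nearI je (left_near_gap eD)).
have : S (e - t) <-> S e by apply: HS gt; lra.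
by tauto.
Qed.

Lemma constant_from D S x y :
    (forall x y, x <= y -> gap D x y -> S x <-> S y) -> x <= y ->
    (forall d, d \in D -> x < d <= y -> S d <-> S x) ->
  S y <-> S x.
Proof.
move=> HS xy Hd; have [gxy|[d0 d0D d0xy]] := gapP D x y.
  by rewrite (HS x y).
have [m [mD mxy] mmax] := seq_max (P := fun d => x < d <= y) d0D d0xy.
rewrite -(HS m y); first exact: Hd; first by case/andP: mxy.
move=> d dD; apply/negP => /andP[md dy].
suff : d <= m by lra.
by apply: mmax => //; move: mxy; lra.
Qed.

Lemma exists_jump S x y : elementary S -> x <= y -> ~ (S x <-> S y) ->
  exists2 e, x < e <= y & jump S e.
Proof.
move=> [D HS] xy nS.
have [d0 [d0D d0P]] :
    exists d, d \in D /\ (x < d <= y) && ~~ `[< S d <-> S x >].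
  apply: contrapT => nex; apply: nS; rewrite (constant_from HS xy) //.
  move=> d dD dxy; apply: contrapT => nSd; apply: nex; exists d.
  by split=> //; rewrite dxy /=; apply/asboolP.
(* The first breakpoint at which [S] differs from its value at [x]. *)
have [e [eD /andP[exy /asboolP nSe]] emin] :=
  @seq_argmin R _ (fun u : R => u)
    (fun d => (x < d <= y) && ~~ `[< S d <-> S x >]) D d0 d0D d0P.
exists e => //; exists (e - x); first by lra.
move=> t te; rewrite (constant_from (x := x) (y := e - t) HS); [|lra|].
  by have [|] := pselect (S x); have [|] := pselect (S e); tauto.
move=> d dD dxe; apply: contrapT => nSd.
suff : e <= d by lra.
by apply: emin => //; apply/andP; split; [lra|apply/asboolP].
Qed.

Definition act_invariant f S := forall x, S (act f x) <-> S x.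

Lemma act_invariantX f n S : act_invariant f S -> act_invariant (f ^+ n)%g S.
Proof.
move=> Sf x; elim: n => [|n IH]; first by rewrite expg0 act1.
by rewrite actS Sf IH.
Qed.

Lemma act_invariantV f S : act_invariant f S -> act_invariant f^-1%g S.
Proof. by move=> Sf x; rewrite -{2}(actVK f x) Sf. Qed.

Lemma jump_act D f S e : translates_on D (act f) -> act_invariant f S ->
  e \notin D -> jump S (act f e) <-> jump S e.
Proof.
move=> HD Sf eD; have tr := left_near_translates HD eD.
by split=> je; apply: left_nearW (left_nearI tr je) => t _ [ft];
  rewrite -ft !Sf.
Qed.

(** At a jump, either [e] or the points just left of it lie in [S], yet f^p fixes both. *)
Lemma jump_not_per f S e p : (forall x, S x -> ~ per f x) -> (0 < p)%N ->
    act (f ^+ p)%g e = e ->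
    left_near (fun t => act (f ^+ p)%g (e - t) = e - t) ->
  ~ jump S e.
Proof.
move=> Saper p0 fpe near_p je.
have [t t0 [St ft]] := left_near_ex (left_nearI je near_p).
have nSe : ~ S e by move=> /Saper; apply; exists p.
by have /Saper[] : S (e - t); [apply/St|exists p].
Qed.

(** If the forward orbit missed [D], every iterate of [e] would be a jump. Jumps are finite in
    number, so [e] would be periodic together with its left germ. *)
Lemma jump_hits_future D f S e : translates_on D (act f) -> elementary S ->
    act_invariant f S -> (forall x, S x -> ~ per f x) -> jump S e ->
  exists n, act (f ^+ n)%g e \in D.
Proof.
move=> HD [E HE] Sf Saper je; apply: contrapT => nex.
have nD n : act (f ^+ n)%g e \notin D.
  by apply/negP => nD; apply: nex; exists n.
have jn n : jump S (act (f ^+ n)%g e).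
  elim: n => [|n IH]; first by rewrite expg0 act1.
  by rewrite actS; apply/(jump_act HD Sf).
have tr n : left_near (fun t => act (f ^+ n)%g (e - t) = act (f ^+ n)%g e - t).
  elim: n => [|n IH]; first by exists 1 => // t _; rewrite expg0 !act1.
  apply: left_nearW (left_nearI IH (left_near_translates HD (nD n))).
  by move=> t _ [fn ft]; rewrite !actS fn ft.
have [|i [j [ij fij]]] := @pigeonhole _ E (fun n => act (f ^+ n)%g e).
  by move=> n; exact: jump_breakpoint HE (jn n).
have fp : act (f ^+ (j - i))%g e = e.
  apply: (@act_inj _ (f ^+ i)%g).
  by rewrite -actD subnKC ?(ltnW ij).
apply: (jump_not_per Saper _ fp _ je); first by rewrite subn_gt0.
by have := tr (j - i)%N; rewrite fp.
Qed.

(** The same argument backwards. The exponent starts at 1, because a jump is pulled back from f y to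
    y when y is not in [D]. *)
Lemma jump_hits_past D f S e : translates_on D (act f) -> elementary S ->
    act_invariant f S -> (forall x, S x -> ~ per f x) -> jump S e ->
  exists m, act (f^-1 ^+ m.+1)%g e \in D.
Proof.
move=> HD [E HE] Sf Saper je; apply: contrapT => nex.
have nD m : act (f^-1 ^+ m.+1)%g e \notin D.
  by apply/negP => mD; apply: nex; exists m.
have bk m : act f (act (f^-1 ^+ m.+1)%g e) = act (f^-1 ^+ m)%g e.
  by rewrite actS actVK.
have jm m : jump S (act (f^-1 ^+ m)%g e).
  elim: m => [|m IH]; first by rewrite expg0 act1.
  by apply/(jump_act HD Sf (nD m)); rewrite bk.
have tr m :
    left_near (fun t => act (f^-1 ^+ m)%g (e - t) = act (f^-1 ^+ m)%g e - t).
  elim: m => [|m IH]; first by exists 1 => // t _; rewrite expg0 !act1.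
  apply: left_nearW (left_nearI IH (left_near_translates HD (nD m))).
  move=> t _ [fm]; rewrite bk => ft.
  by rewrite actS fm -ft actK.
have [|i [j [ij fij]]] := @pigeonhole _ E (fun n => act (f^-1 ^+ n)%g e).
  by move=> m; exact: jump_breakpoint HE (jm m).
have fp : act (f^-1 ^+ (j - i))%g e = e.
  apply: (@act_inj _ (f^-1 ^+ i)%g).
  by rewrite -actD subnKC ?(ltnW ij).
have fp' : act (f ^+ (j - i))%g e = e by rewrite -{1}fp actNXVK.
apply: (jump_not_per Saper _ fp' _ je); first by rewrite subn_gt0.
have := tr (j - i)%N; rewrite fp; apply: left_nearW => t _ ft.
by rewrite -{1}ft actNXVK.
Qed.

(** Every jump lies on an orbit segment between two visits to the breakpoints of [f], and these
    segments are independent of [S]. *)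
Lemma invariant_endpoints f :
  exists E : seq R, forall S, elementary S -> act_invariant f S ->
    (forall x, S x -> ~ per f x) ->
    forall x y, x <= y -> gap E x y -> S x <-> S y.
Proof.
have [D HD] := act_piecewise f; have [E HE] := orbit_segments_finite f D.
exists E => S Sel Sf Saper x y xy gxy; apply: contrapT => nS.
have [e exy je] := exists_jump Sel xy nS.
have /negP[] := gxy e (HE e (jump_hits_future HD Sel Sf Saper je)
                         (jump_hits_past HD Sel Sf Saper je)).
exact: exy.
Qed.

(** Members of the family are determined by their values on the finite list [0 :: E], where 0 serves
    the points left of all of [E]. A member containing the most sample points is therefore
    maximal. *)
Lemma maximal_invariant_set f (Fam : (R -> Prop) -> Prop) S0 :
    (forall S, Fam S ->
       [/\ elementary S, act_invariant f S & forall x, S x -> ~ per f x]) ->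
    Fam S0 ->
  exists2 B, Fam B & forall S, Fam S -> (forall x, B x -> S x) ->
    forall x, S x -> B x.
Proof.
move=> Famf S0F; have [E HE] := invariant_endpoints f.
pose c S := count (fun e => `[< S e >]) (0 :: E).
pose Q n := `[< exists2 S, Fam S & c S = n >].
have exQ : exists n, Q n by exists (c S0); apply/asboolP; exists S0.
have leQ n : Q n -> (n <= (size E).+1)%N.
  by move=> /asboolP[S _ <-]; exact: count_size.
have [_ /asboolP[B BF <-] Bmax] := ex_maxnP exQ leQ.
exists B => // S SF BS x Sx; apply: contrapT => nBx.
suff : (c B < c S)%N.
  by rewrite ltnNge Bmax //; apply/asboolP; exists S.
have [Bel Bf Baper] := Famf B BF; have [Sel Sf Saper] := Famf S SF.
have /andP[x0 _] := aper_in (Saper x Sx).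
have [m [mE mx] mmax] :=
  @seq_max R (fun d => d <= x) (0 :: E) 0 (mem_head _ _) x0.
have gmx : gap E m x.
  move=> d dE; apply/negP => /andP[md dx].
  by move: (mmax d); rewrite inE dE orbT => /(_ isT dx); lra.
apply: (@count_lt _ _ _ _ m) => //.
- by move=> y /asboolP By; apply/asboolP; exact: BS.
- by apply/asboolP/(HE S Sel Sf Saper m x).
- by apply/asboolP; rewrite (HE B Bel Bf Baper m x).
Qed.

End InvariantSets.

(** * Regluing of germs *)

Section Regluing.
Variables (R : realType) (g : iet R).
Implicit Types (x y v : R) (s : iet R).

(* [glued x v]: far along the forward [g]-orbit, the images of the left germ
   at [v] and of the right germ at [x] are adjacent. *)
Definition glued x v := exists k0, forall k, (k0 <= k)%N ->
  left_near (fun t => act (g ^+ k)%g (v - t) = act (g ^+ k)%g x - t).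

(** The orbit of [x] eventually leaves the breakpoints of [g], and from then on point and left germ
    move together. Pulling that left germ back by g^(-k0) gives [v]. *)
Lemma glued_exists x : ~ per g x -> exists v, glued x v.
Proof.
move=> nper; have [D HD] := act_piecewise g.
have [k0 Hk0] := injective_leaves D (aper_inj nper).
have [v Hv] := left_limit (act (g ^+ k0)%g x) (act_piecewise (g^-1 ^+ k0)%g).
exists v, k0 => k kk; rewrite -(subnK kk).
elim: (k - k0)%N => [|j IH].
  by apply: left_nearW Hv => t _ <-; rewrite add0n actNXVK.
have gjD : act (g ^+ (j + k0))%g x \notin D by apply: Hk0; exact: leq_addl.
apply: left_nearW (left_nearI IH (left_near_translates HD gjD)).
by move=> t _ [gv gx]; rewrite addSn !actS gv gx.
Qed.

Lemma glued_unique x v v' : glued x v -> glued x v' -> v = v'.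
Proof.
move=> [k Hk] [k' Hk'].
have [t _ [e e']] := left_near_ex (left_nearI (Hk _ (leq_maxl k k'))
                                              (Hk' _ (leq_maxr k k'))).
by move: e; rewrite -e' => /act_inj /addIr.
Qed.

(** For large k the point g^k x avoids the breakpoints of [s], so [s] moves the two adjacent germs
    there by the same translation. *)
Lemma glued_act s x v v' : commute g s -> ~ per g x -> glued x v ->
  left_near (fun t => act s (v - t) = v' - t) -> glued (act s x) v'.
Proof.
move=> gs nper [k0 Hk0] sv; have [D HD] := act_piecewise s.
have [n0 Hn0] := injective_leaves D (aper_inj nper).
exists (maxn k0 n0) => k; rewrite geq_max => /andP[kk nk].
have cX := commute_sym (commuteX k (commute_sym gs)).
apply: left_nearW (left_nearI (left_nearI (Hk0 k kk) sv)
                     (left_near_translates HD (Hn0 k nk))).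
by move=> t _ [[gv <-] sx]; rewrite !(act_commute _ cX) gv sx.
Qed.

Lemma glued_refl D x : translates_on D (act g) ->
  (forall k, act (g ^+ k)%g x \notin D) -> glued x x.
Proof.
move=> HD xD; exists 0%N => k _; elim: k => [|k IH].
  by exists 1 => // t _; rewrite expg0 !act1.
apply: left_nearW (left_nearI IH (left_near_translates HD (xD k))).
by move=> t _ [gv gx]; rewrite !actS gv gx.
Qed.

(** By [glued_exists], the default value can occur only at periodic points of [g]. *)
Definition glue x : R :=
  if pselect (exists v, glued x v) is left vP then projT1 (cid vP) else x.

Lemma glueP x : ~ per g x -> glued x (glue x).
Proof.
by move=> /glued_exists vP; rewrite /glue; case: pselect => // e; case: cid.
Qed.

Lemma glueE x v : glued x v -> glue x = v.
Proof.
rewrite /glue => xv; case: pselect => [e|[]]; last by exists v.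
by case: cid => v' /= xv'; exact: glued_unique xv' xv.
Qed.

(** Off its breakpoints [s] carries the left germ at [x] to the one at s x, and by injectivity no
    other left germ goes there. *)
Lemma glue_act D s x : commute g s -> ~ per g x -> translates_on D (act s) ->
  x \notin D -> glue (act s x) = act s x <-> glue x = x.
Proof.
move=> gs nper HD xD; have sx := left_near_translates HD xD.
split=> [ex|ex].
  have [v' sv'] := left_limit (glue x) (act_piecewise s).
  have := glueE (glued_act gs nper (glueP nper) sv'); rewrite ex => ev'.
  have [t _ []] := left_near_ex (left_nearI sv' sx).
  by rewrite -ev' => <- /act_inj /addIr.
by apply: glueE; apply: glued_act sx => //; rewrite -{2}ex; exact: glueP.
Qed.

End Regluing.

(** * Close returns of an injective sequence *)

Lemma seq_pos_lb (R : realType) (s : seq R) :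
  exists2 eps : R, 0 < eps & forall a, a \in s -> 0 < a -> eps <= a.
Proof.
elim: s => [|b s [e e0 IH]]; first by exists 1.
have [b0|b0] := ltP 0 b; last first.
  exists e => // a; rewrite inE => /predU1P[->|]; [lra|exact: IH].
exists (Num.min e b); first by rewrite lt_min e0.
move=> a; rewrite inE ge_min => /predU1P[->|/IH ea] a0.
  by rewrite lexx orbT.
by rewrite ea.
Qed.

Lemma close_returns (R : realType) (u : nat -> R) (E : seq R) (eps : R) :
    0 < eps -> (forall n, 0 <= u n < 1) -> injective u ->
  exists i j, 0 < u j - u i < eps /\ gap E (u i) (u j).
Proof.
move=> eps0 u01 inj_u.
pose M := (Num.truncn eps^-1).+1.
have M0 : 0 < M%:R :> R by rewrite ltr0n.
have MV : M%:R^-1 < eps.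
  rewrite invf_plt ?posrE //; exact: truncnS_gt.
(* A grid of mesh 1/M < eps together with [E]. Terms with equally many points of [D] at or below
   them lie in the same cell. *)
pose D := [seq k%:R / M%:R | k <- iota 0 M.+1] ++ E.
pose c (x : R) := count (fun d => d <= x) D.
suff main i j : u i < u j -> c (u i) = c (u j) ->
    0 < u j - u i < eps /\ gap E (u i) (u j).
  have [|i [j [ij cij]]] := @pigeonhole _ (iota 0 (size D).+1) (c \o u).
    by move=> n; rewrite mem_iota /= add0n ltnS count_size.
  case: (ltgtP (u i) (u j)) => [uij|uji|/inj_u eij].
  - by exists i, j; apply: main.
  - by exists j, i; apply: main.
  - by move: ij; rewrite eij ltnn.
move=> uij cij; have gD : gap D (u i) (u j).
  move=> d dD; apply/negP => /andP[id dj].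
  suff : (c (u i) < c (u j))%N by rewrite cij ltnn.
  apply: (count_lt (x := d)) => //; last by rewrite -ltNge.
  by move=> y yi; exact: le_trans yi (ltW uij).
have [gG gE] := (gap_cat _ _ _ _).1 gD; split=> //.
rewrite subr_gt0 uij /= ltNge; apply/negP => epsij.
have /andP[ui0 ui1] := u01 i.
pose k := Num.truncn (u i * M%:R).
have uM0 : 0 <= u i * M%:R by rewrite mulr_ge0 // ltW.
have kle : k%:R <= u i * M%:R by rewrite /k truncn_le.
have kgt : u i * M%:R < k.+1%:R by exact: truncnS_gt.
have kM : (k < M)%N.
  rewrite -(ltr_nat R); apply: le_lt_trans kle _.
  by rewrite gtr_pMl.
have /gG : (k.+1%:R / M%:R : R) \in [seq k%:R / M%:R | k <- iota 0 M.+1].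
  by apply/mapP; exists k.+1 => //; rewrite mem_iota /= add0n !ltnS.
rewrite ltr_pdivlMr // kgt /= => /negP; apply.
apply: le_trans (_ : u i + M%:R^-1 <= _); last by lra.
rewrite ler_pdivrMr // mulrDl mulVf ?lt0r_neq0 // -natr1.
by rewrite lerD2r.
Qed.

(** * Identities satisfied by a reverser *)

Section Reversers.
Variables (R : realType) (f h : iet R).
Hypothesis rev : (h * f = f^-1 * h)%g.

Lemma rev_act x : act h (act f x) = act f^-1%g (act h x).
Proof. by rewrite -!act_mul rev. Qed.

Lemma rev_actV x : act h (act f^-1%g x) = act f (act h x).
Proof. by rewrite -{2}(actVK f x) rev_act actVK. Qed.

Lemma rev_actX n x : act h (act (f ^+ n)%g x) = act (f^-1 ^+ n)%g (act h x).
Proof.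
by elim: n => [|n IH]; rewrite ?expg0 ?act1 // !actS rev_act IH.
Qed.

Lemma rev_actVX n x : act h (act (f^-1 ^+ n)%g x) = act (f ^+ n)%g (act h x).
Proof.
by elim: n => [|n IH]; rewrite ?expg0 ?act1 // !actS rev_actV IH.
Qed.

Lemma rev_sqr_commute : commute (h * h)%g f.
Proof.
by apply: act_eqP => x; rewrite !act_mul rev_act rev_actV.
Qed.

Lemma rev_per x : per f (act h x) <-> per f x.
Proof.
split=> -[p p0 fp]; exists p => //.
  apply: (@act_inj _ h); rewrite rev_actX.
  by rewrite -{1}fp actNXK.
by rewrite -[in LHS]fp rev_actX actNXVK.
Qed.

End Reversers.

(** * The free region *)

Section FreeRegion.
Variables (R : realType) (f h : iet R) (U : R -> Prop).
Implicit Types (x y v e : R) (s : iet R).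
Local Notation g := (h * h)%g.
Hypothesis rev : (h * f = f^-1 * h)%g.
Hypothesis Uel : elementary U.
Hypothesis Uf : act_invariant f U.
Hypothesis Uh : act_invariant h U.
Hypothesis Uaper : forall x, U x -> ~ per f x.
(** Together with [Uaper], this says that [f] and [g] generate a free action of Z^2 on [U]; natural
    exponents of [f] suffice after multiplying by a power of [f]. *)
Hypothesis Ufree : forall x k i j, U x -> (0 < k)%N ->
  act (g ^+ k)%g (act (f ^+ i)%g x) <> act (f ^+ j)%g x.

Let gf : commute g f := rev_sqr_commute rev.
Let gh : commute g h. Proof. by rewrite /commute mulgA. Qed.

Let Uaper_g x : U x -> ~ per g x.
Proof.
move=> Ux [k k0 gk]; apply: (Ufree (i := 0%N) (j := 0%N) Ux k0).
by rewrite expg0 act1.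
Qed.

Let no_collision x a b i j : U x -> (i < j)%N ->
  act (g ^+ a)%g (act (f ^+ i)%g x) <> act (g ^+ b)%g (act (f ^+ j)%g x).
Proof.
move=> Ux ij e; case: (ltngtP a b) => ab.
- apply: (@Ufree x (b - a)%N j i) => //; first by rewrite subn_gt0.
  by apply: (@act_inj _ (g ^+ a)%g); rewrite -actD subnKC ?(ltnW ab).
- apply: (@Ufree x (a - b)%N i j) => //; first by rewrite subn_gt0.
  by apply: (@act_inj _ (g ^+ b)%g); rewrite -actD subnKC ?(ltnW ab).
- move: e; rewrite ab => /act_inj /(aper_inj (Uaper Ux)) eij.
  by rewrite eij ltnn in ij.
Qed.

Let hits_g_breakpoint D x : translates_on D (act g) -> glue g x <> x ->
  exists k, act (g ^+ k)%g x \in D.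
Proof.
move=> HD gx; apply: contrapT => nex; apply: gx; apply/glueE/(glued_refl HD).
by move=> k; apply/negP => kD; apply: nex; exists k.
Qed.

(** If one half of the [f]-orbit of [x] avoided the breakpoints of [f], nontrivial gluing would
    spread along it. Each of its points would then reach one of the finitely many breakpoints of [g]
    under powers of [g], and two would collide, against freeness. So [x] lies between two visits to
    the breakpoints of [f]. *)
Lemma glue_finite : exists E : seq R, forall x, U x -> glue g x <> x -> x \in E.
Proof.
have [D HD] := act_piecewise f; have [Dg HDg] := act_piecewise g.
have [E HE] := orbit_segments_finite f D.
exists E => x Ux gx; apply: HE.
  apply: contrapT => nex.
  have nD n : act (f ^+ n)%g x \notin D.
    by apply/negP => nD; apply: nex; exists n.
  have gn n : glue g (act (f ^+ n)%g x) <> act (f ^+ n)%g x.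
    elim: n => [|n IH]; first by rewrite expg0 act1.
    rewrite actS => /(glue_act gf _ HD (nD n)).1; apply: contra_not IH.
    by apply; apply: Uaper_g; apply/act_invariantX.
  have Hk n := hits_g_breakpoint HDg (gn n).
  pose k n := projT1 (cid (Hk n)).
  have [|i [j [ij]]] := @pigeonhole _ Dg
      (fun n => act (g ^+ k n)%g (act (f ^+ n)%g x)).
    by move=> n; rewrite /k; case: cid.
  exact: no_collision.
apply: contrapT => nex.
have nD n : act (f^-1 ^+ n.+1)%g x \notin D.
  by apply/negP => nD; apply: nex; exists n.
have Uf' n : U (act (f^-1 ^+ n)%g x) by apply/act_invariantX/Ux/act_invariantV.
have gn n : glue g (act (f^-1 ^+ n)%g x) <> act (f^-1 ^+ n)%g x.
  elim: n => [|n IH]; first by rewrite expg0 act1.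
  apply: contra_not IH.
  move=> /(glue_act gf (Uaper_g (Uf' _)) HD (nD n)).2.
  by rewrite actS actVK.
have Hk n := hits_g_breakpoint HDg (gn n).
pose k n := projT1 (cid (Hk n)).
have [|i [j [ij]]] := @pigeonhole _ Dg
    (fun n => act (g ^+ k n)%g (act (f^-1 ^+ n)%g x)).
  by move=> n; rewrite /k; case: cid.
have cX a n := commuteX2 a n gf.
(* Applying f^j to a collision on the backward orbit makes its exponents natural. *)
have move_to a n y m : (n <= m)%N ->
    act (f ^+ m)%g (act (g ^+ a)%g (act (f^-1 ^+ n)%g y)) =
    act (g ^+ a)%g (act (f ^+ (m - n))%g y).
  move=> nm; rewrite -(act_commute _ (cX a m)); congr (act _ _).
  by rewrite -{1}(subnK nm) actD actNXVK.
move=> /(congr1 (act (f ^+ j)%g)); rewrite !move_to ?(ltnW ij) // subnn.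
by move/esym; apply: no_collision; rewrite ?subn_gt0.
Qed.

Lemma swap_subregion x0 : U x0 ->
  exists C, [/\ elementary C, act_invariant f C, act_invariant g C,
    forall x, C x -> U x /\ ~ C (act h x) & exists y, C y].
Proof.
move=> Ux0; have [E0 HE0] := glue_finite; have [DU HDU] := Uel.
have [Df HDf] := act_piecewise f; have [Dh HDh] := act_piecewise h.
pose E := E0 ++ (DU ++ (Df ++ Dh)).
have E0E : {subset E0 <= E} by move=> d dE; rewrite mem_cat dE.
have DUE : {subset DU <= E} by move=> d dE; rewrite !mem_cat dE orbT.
have DfE : {subset Df <= E} by move=> d dE; rewrite !mem_cat dE !orbT.
have DhE : {subset Dh <= E} by move=> d dE; rewrite !mem_cat dE !orbT.
(* A window (x - delta, x] with delta < eps holds at most one point of [E], and no point of [E] lies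
   within eps to the left of a glued value. *)
have [eps eps0 Heps] :=
  seq_pos_lb ([seq e' - e | e <- E, e' <- E] ++
              [seq glue g e - e' | e <- E, e' <- E]).
have sepE e e' : e \in E -> e' \in E -> e < e' -> eps <= e' - e.
  move=> eE e'E ee'; apply: Heps; last by lra.
  by rewrite mem_cat; apply/orP; left; apply/allpairsP; exists (e, e').
have sepG e e' : e \in E -> e' \in E -> e' < glue g e -> eps <= glue g e - e'.
  move=> eE e'E ee'; apply: Heps; last by lra.
  by rewrite mem_cat; apply/orP; right; apply/allpairsP; exists (e, e').
pose J := undup [seq e <- E | `[< U e >] && (glue g e != e)].
have JP e : e \in J <-> U e /\ glue g e <> e.
  rewrite mem_undup mem_filter; split.
    by move=> /andP[/andP[/asboolP Ue /eqP ge] _].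
  move=> [Ue ge]; apply/andP; split; last by apply: E0E; exact: HE0.
  by apply/andP; split; [apply/asboolP|apply/eqP].
have JE e : e \in J -> e \in E by rewrite mem_undup mem_filter => /andP[].
(* [psi delta] moves points to the left by [delta] across the regluing. *)
pose psi (delta x : R) :=
  x - delta + \sum_(e <- J | e <= x < e + delta) (glue g e - e).
have psi_regular delta x :
    (forall e, e \in J -> ~~ (x - delta < e <= x)) -> psi delta x = x - delta.
  move=> H; rewrite /psi big1_seq ?addr0 // => e /andP[ex eJ].
  by have := H e eJ; lra.
have psi_single delta x e : U e -> x - delta < e <= x ->
    (forall e', e' \in J -> x - delta < e' <= x -> e' = e) ->
    psi delta x = x - delta + (glue g e - e).
  move=> Ue ex H; have [eJ|eJ] := boolP (e \in J).
    congr (_ + _); rewrite big_mkcond (bigD1_seq e) ?undup_uniq //=.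
    rewrite ifT; last by lra.
    rewrite big1_seq ?addr0 // => e' /andP[/eqP e'e e'J].
    by case: ifP => // e'x; case: e'e; apply: H => //; lra.
  have -> : glue g e = e.
    by apply: contrapT => ge; case/negP: eJ; apply/JP.
  rewrite subrr addr0 psi_regular // => e' e'J; apply/negP => /(H _ e'J) e'e.
  by rewrite -e'e e'J in eJ.
have psi_commute s D (delta x : R) :
    translates_on D (act s) -> {subset D <= E} ->
    commute g s -> act_invariant s U -> U x -> 0 < delta < eps ->
    act s (psi delta x) = psi delta (act s x).
  move=> HD DE gs Us Ux delta_eps.
  (* Points off [E] are trivially glued, and so are their images. *)
  have reg y : U y -> y \notin E -> act s y \notin J.
    move=> Uy yE; apply/negP => /JP[_]; apply.
    apply/(glue_act gs (Uaper_g Uy) HD); first exact: contra (DE y) yE.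
    by apply: contrapT => gy; case/negP: yE; apply: E0E; exact: HE0.
  have slide y z : y <= z -> gap E y z ->
      act s z = act s y + (z - y) /\ (U y <-> U z).
    by move=> yz gyz; split; [apply: HD|apply: HDU] => // d dD;
      apply: gyz; [exact: DE|exact: DUE].
  (* Either [s] translates the whole window, or exactly one [e] is crossed. Then the path continues
     to the left of [v], and [s] sends that germ to the one glued to s e. *)
  have [gx|[e eE ex]] := gapP E (x - delta) x.
    have -> : psi delta x = x - delta.
      by apply: psi_regular => e /JE eE; exact: gx.
    have [sx _] : act s x = act s (x - delta) + (x - (x - delta)) /\
        (U (x - delta) <-> U x) by apply: slide => //; lra.
    rewrite psi_regular; first by lra.
    move=> e2 e2J; apply/negP => e2x; pose y := x - (act s x - e2).
    have yx : x - delta < y <= x by rewrite /y; lra.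
    have [sy Uy] : act s x = act s y + (x - y) /\ (U y <-> U x).
      by apply: slide; [lra|apply: gap_sub gx; lra].
    have e2E : act s y = e2 by rewrite /y in sy *; lra.
    have yE : y \notin E by apply/negP => /gx; rewrite yx.
    by have := reg y (Uy.2 Ux) yE; rewrite e2E e2J.
  have gex : gap E e x.
    move=> d dE; apply/negP => ed; have := sepE e d eE dE; lra.
  have [|sx Ue] := slide e x _ gex; first by lra.
  have {}Ue : U e by apply/Ue.
  set v := glue g e.
  have gv (t t' : R) : 0 < t' <= t -> t < eps -> gap E (v - t) (v - t').
    move=> tt' te d dE; apply/negP => vd; have := sepG e d eE dE; rewrite -/v.
    lra.
  have [v' sv'] := left_limit v (act_piecewise s).
  have near_le (t : R) : 0 < t -> left_near (fun t' : R => t' <= t).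
    by move=> t0; exists t => // t' /andP[_ /ltW].
  have sv (t : R) : 0 < t < eps -> act s (v - t) = v' - t.
    move=> te; have [|t1 t10 [st1 t1t]] :=
      left_near_ex (left_nearI sv' (near_le t _)); first by lra.
    have tt1 : v - t <= v - t1 by lra.
    have gtt1 : gap E (v - t) (v - t1) by apply: gv; lra.
    have [sl _] := slide _ _ tt1 gtt1.
    by rewrite sl in st1; lra.
  (* Far along the [g]-orbit these points become adjacent to g^k e, which lies in [U]. *)
  have Uv (t : R) : 0 < t < eps -> U (v - t).
    move=> te; have [k0 Hk0] := glueP (Uaper_g Ue).
    have [n0 Hn0] := injective_leaves DU (aper_inj (Uaper_g Ue)).
    pose k := maxn k0 n0.
    have nk := left_nearI (Hk0 k (leq_maxl _ _))
                          (left_near_gap (Hn0 k (leq_maxr _ _))).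
    have [|t1 t10 [[gt1 gapt1] t1t]] :=
      left_near_ex (left_nearI nk (near_le t _)); first by lra.
    have Ug : act_invariant (g ^+ k)%g U.
      by apply: act_invariantX => y; rewrite act_mul !Uh.
    have Ut1 : U (v - t1).
      apply/Ug; rewrite gt1; apply/(HDU _ _ _ gapt1); first by lra.
      exact/Ug.
    have tt1 : v - t <= v - t1 by lra.
    have gtt1 : gap E (v - t) (v - t1) by apply: gv; lra.
    by have [_ ->] := slide _ _ tt1 gtt1.
  have -> : psi delta x = x - delta + (v - e).
    apply: psi_single => // e' /JE e'E e'x.
    case: (ltgtP e' e) => // ee'.
      by have := sepE e' e e'E eE; lra.
    by have := sepE e e' eE e'E; lra.
  have se : glued g (act s e) v'.
    by apply: (glued_act gs (Uaper_g Ue) _ sv'); apply: glueP; exact: Uaper_g.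
  rewrite (psi_single _ _ (act s e)) ?(glueE se); last 3 first.
  - exact/Us.
  - by lra.
  (* A second crossing [e2] would be too close to s e if that point is in [J]; otherwise it is the
     image of a point [y] off [E], against [reg]. *)
  - move=> e2 e2J e2x; case: (ltgtP e2 (act s e)) => // e2e.
      have [seJ|seJ] := boolP (act s e \in J).
        by have := sepE e2 (act s e) (JE _ e2J) (JE _ seJ); lra.
      have v'E : v' = act s e.
        rewrite -(glueE se); apply: contrapT => gse; case/negP: seJ.
        by apply/JP; split; first exact/Us.
      pose y := v - (act s e - e2).
      have te : 0 < act s e - e2 < eps by lra.
      have yE : y \notin E.
        by apply/negP => yE; have := sepG e y eE yE; rewrite -/v /y; lra.
      have := reg y (Uv _ te) yE; rewrite sv // v'E.
      by have -> : act s e - (act s e - e2) = e2 by [lra]; rewrite e2J.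
    pose y := e + (e2 - act s e).
    have ye : e < y <= x by rewrite /y; lra.
    have gyx : gap E y x by apply: gap_sub gex; lra.
    have [|sy Uy] := slide y x _ gyx; first by lra.
    have yE : y \notin E by apply/negP => /gex; rewrite ye.
    have := reg y (Uy.2 Ux) yE.
    have -> : act s y = e2 by rewrite /y in sy *; lra.
    by rewrite e2J.
  have -> : x - delta + (v - e) = v - (delta - (x - e)) by lra.
  rewrite sv; lra.
have u01 n : 0 <= act (f ^+ n)%g x0 < 1.
  by apply/aper_in/Uaper/act_invariantX.
(* No point of [E] separates these two returns, so [psi delta] is the plain shift there and puts
   [x0] in [C]. *)
have [i [j [delta_eps gij]]] := close_returns E eps0 u01 (aper_inj (Uaper Ux0)).
set delta := (X in 0 < X < _) in delta_eps.
have ij : i <> j by move=> e; move: delta_eps; rewrite /delta e subrr ltxx.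
have psi_f x : U x -> act f (psi delta x) = psi delta (act f x).
  by move=> Ux; apply: (psi_commute f Df).
have psi_h x : U x -> act h (psi delta x) = psi delta (act h x).
  by move=> Ux; apply: (psi_commute h Dh).
have psi_fX n x : U x ->
    act (f ^+ n)%g (psi delta x) = psi delta (act (f ^+ n)%g x).
  move=> Ux; elim: n => [|n IH]; first by rewrite expg0 !act1.
  by rewrite !actS IH psi_f //; apply/act_invariantX.
have psi_g x : U x -> act g (psi delta x) = psi delta (act g x).
  by move=> Ux; rewrite !act_mul psi_h // psi_h //; apply/Uh.
pose C y := U y /\ act (f ^+ i)%g y = psi delta (act (f ^+ j)%g y).
have UfX n x : U (act (f ^+ n)%g x) <-> U x by apply: act_invariantX.
have Cinv s : commute s f -> act_invariant s U ->
    (forall x, U x -> act s (psi delta x) = psi delta (act s x)) ->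
    act_invariant s C.
  move=> sf Us psi_s x; rewrite /C (Us x).
  have sX n := commuteX n sf.
  rewrite -!(act_commute _ (sX _)).
  split=> -[Ux]; last by move=> ->; rewrite psi_s //; apply/UfX.
  by rewrite -psi_s; [move=> /act_inj|apply/UfX].
exists C; split.
- apply: elementary_and => //.
  have psi_pw : piecewise_translation (psi delta).
    (* The correction term of [e] switches on at [e] and off at e + delta. *)
    exists (J ++ [seq e + delta | e <- J]) => x y xy /gap_cat[g1 g2].
    have same_terms : \sum_(e <- J | e <= y < e + delta) (glue g e - e) =
        \sum_(e <- J | e <= x < e + delta) (glue g e - e).
      rewrite big_seq_cond [RHS]big_seq_cond; apply: eq_bigl => e.
      case eJ: (e \in J) => //=; have := g1 e eJ.
      have := g2 (e + delta) (map_f _ eJ).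
      by move=> g2e g1e; apply/idP/idP => exy; lra.
    by rewrite /psi same_terms; lra.
  (* In this form [C] is the preimage under f^j of a coincidence set. *)
  apply: (@elementary_ext _
      (fun y => act (f ^+ i * f^-1 ^+ j)%g (act (f ^+ j)%g y) =
                psi delta (act (f ^+ j)%g y))).
    by move=> y; rewrite act_mul actNXK.
  apply: (elementary_act (f ^+ j)%g
            (S := fun z => act (f ^+ i * f^-1 ^+ j)%g z = psi delta z)).
  by apply: elementary_eq => //; exact: act_piecewise.
- exact: Cinv.
- by apply: Cinv => // x; rewrite act_mul !Uh.
- move=> y [Uy fy]; split=> // -[_].
  rewrite -!(rev_actVX rev) -psi_h; last first.
    by apply/act_invariantX => //; exact: act_invariantV.
  (* If h y were also in [C], this gives f^j y = psi (f^i y). Combined with f^i y = psi (f^j y), it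
     forces f^(2i) y = f^(2j) y, so i = j. *)
  move=> /act_inj /(congr1 (act (f ^+ (i + j))%g)).
  have Uy' : U (act (f^-1 ^+ j)%g y).
    by apply/act_invariantX => //; exact: act_invariantV.
  rewrite psi_fX // {1}addnC !actD !actNXVK => fy'.
  have e2 : act (f ^+ (i + i))%g y = act (f ^+ (j + j))%g y.
    rewrite actD fy psi_fX ?UfX // actXC -psi_fX ?UfX // -fy'.
    by rewrite -actD.
  by apply: ij; have := aper_inj (Uaper Uy) e2; lia.
- exists x0; split=> //; rewrite psi_regular; first by rewrite /delta; lra.
  move=> e /JE eE; have := gij e eE; rewrite /delta; lra.
Qed.

End FreeRegion.

(** * A reverser of finite order *)

Section PeriodicPart.
Variables (R : realType) (f : iet R).
Implicit Types (x : R) (k n : nat).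

Lemma per_act x : per f (act f x) <-> per f x.
Proof. by have := per_orbit f 1 x; rewrite expg1. Qed.

Lemma elementary_asbool (S : R -> Prop) :
  elementary S -> elementary (fun x => `[< S x >] : bool).
Proof. by apply: elementary_ext => x; split=> [/asboolP|/asboolP]. Qed.

(* On an orbit with least element [m], this is the reflection
   [f^i m |-> f^(-i) m]: if [f^k x = m] then [x] goes to [f^(2k) x]. *)
Lemma orbit_reflection : exists tau : R -> R,
  [/\ piecewise_translation tau,
      forall x, ~~ (0 <= x < 1) -> tau x = x,
      forall x, per f x -> per f (tau x) /\ tau (tau x) = x &
      forall x, per f x -> act f (tau (act f x)) = tau x].
Proof.
have [N N0 HN] := period_bound f.
pose A k x := forall j, (j < N)%N -> act (f ^+ k)%g x <= act (f ^+ j)%g x.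
pose fix tau n (x : R) {struct n} : R := if n is n'.+1 then
  if `[< A n' x >] then act (f ^+ (n' + n'))%g x else tau n' x else x.
have tau_ex n x k : (k < n)%N -> A k x ->
    exists2 k', A k' x & tau n x = act (f ^+ (k' + k'))%g x.
  elim: n => [//|n IH] kn Ak /=; case: asboolP => [An|nAn]; first by exists n.
  apply: IH => //; move: kn; rewrite ltnS leq_eqVlt => /predU1P[kn|//].
  by case: nAn; rewrite -kn.
have A_all k x : per f x -> A k x ->
    forall j, act (f ^+ k)%g x <= act (f ^+ j)%g x.
  move=> px Ak j; rewrite [in leRHS](divn_eq j N) addnC actD.
  by rewrite (act_mulnX _ (HN x px)); apply: Ak; rewrite ltn_mod.
(* Asking for N <= k makes k positive, so that it has a predecessor when [x] is replaced by f x. *)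
have least x : per f x -> exists k,
    (N <= k)%N /\ forall j, act (f ^+ k)%g x <= act (f ^+ j)%g x.
  move=> px; have i0 : 0%N \in iota 0 N by rewrite mem_iota.
  have [k [ki _] kmin] :=
    seq_argmin (fun j => act (f ^+ j)%g x) (P := predT) i0 isT.
  exists (k + N)%N; split; first exact: leq_addl.
  rewrite actD (HN x px); apply: A_all => // j jN.
  by apply: kmin; rewrite ?mem_iota.
(* The value does not depend on which exponent reaches the least point. *)
have tauE k x : per f x ->
    (forall j, act (f ^+ k)%g x <= act (f ^+ j)%g x) ->
    tau N x = act (f ^+ (k + k))%g x.
  move=> px kmin; have [||k' Ak' ->] := @tau_ex N x (k %% N)%N.
  - by rewrite ltn_mod.
  - move=> j _; have := kmin j; rewrite {1}(divn_eq k N) addnC actD.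
    by rewrite (act_mulnX _ (HN x px)).
  have kk' : act (f ^+ k)%g x = act (f ^+ k')%g x.
    by apply: le_anti; rewrite kmin A_all.
  by rewrite !actD -kk' actXC -kk'.
exists (tau N); split.
- elim: (N) => [|n IH] /=.
    by exists [::] => x y _ _; lra.
  apply: piecewise_translation_if => //; last exact: act_piecewise.
  apply/elementary_asbool/elementary_forall => j.
  by apply: elementary_le; exact: act_piecewise.
- move=> x xout; elim: (N) => [//|n IH] /=.
  by rewrite act_out // IH; case: ifP.
- move=> x px; have [k [Nk kmin]] := least x px.
  rewrite (tauE k x px kmin); set y := act _ x.
  have py : per f y by apply/per_orbit.
  (* This is -k modulo [N], the exponent leading from y = f^(2k) x to the least point f^k x. *)
  split=> //; pose j := ((2 * N - 1) * k)%N.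
  have jk : act (f ^+ j)%g y = act (f ^+ k)%g x.
    rewrite /y -actD; have -> : (j + (k + k) = k + (2 * k) * N)%N by nia.
    by rewrite actD (act_mulnX _ (HN x px)).
  rewrite (tauE j y py); last by move=> i; rewrite jk /y -actD.
  rewrite /y -actD; have -> : (j + j + (k + k) = (4 * k) * N)%N by nia.
  exact: act_mulnX (HN x px).
- move=> x px; have [[|k] [Nk kmin]] := least x px; first by lia.
  have pfx : per f (act f x) by apply/per_act.
  have shift n : act (f ^+ n)%g (act f x) = act (f ^+ n.+1)%g x.
    by rewrite expgSr act_mul.
  rewrite (tauE k _ pfx); last by move=> j; rewrite !shift.
  by rewrite (tauE k.+1 x px kmin) shift -actS; congr (act (f ^+ _)%g x); lia.
Qed.

End PeriodicPart.

(** * Assembling the reverser *)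

Section ConstructReverser.
Variables (R : realType) (f h : iet R).
Implicit Types x : R.
Local Notation g := (h * h)%g.
Hypothesis rev : (h * f = f^-1 * h)%g.

Let gf : commute g f := rev_sqr_commute rev.
Let gh : commute g h. Proof. by rewrite /commute mulgA. Qed.
Let gfX a n : commute (g ^+ a)%g (f ^+ n)%g := commuteX2 a n gf.
Let ghX a : commute (g ^+ a)%g h := commute_sym (commuteX a (commute_sym gh)).

(** Take [T] maximal among [f]-invariant aperiodic sets on which some power of [g] is the identity.
    Adding the aperiodic points fixed by g^n keeps this property, with exponent [N * n], so [T]
    already contains them. *)
Lemma torsion_region : exists2 T : R -> Prop,
  [/\ elementary T, act_invariant f T & act_invariant h T] &
  (exists2 n, (0 < n)%N & forall x, T x -> act (g ^+ n)%g x = x) /\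
  (forall x n, ~ per f x -> (0 < n)%N -> act (g ^+ n)%g x = x -> T x).
Proof.
pose Fam (S : R -> Prop) :=
  [/\ elementary S, act_invariant f S & forall x, S x -> ~ per f x] /\
  (exists2 n, (0 < n)%N & forall x, S x -> act (g ^+ n)%g x = x).
have Fam0 : Fam (fun=> False).
  by split; [split=> //; exact: elementary_const|exists 1%N].
have [T [[Tel Tf Taper] [N N0 TN]] Tmax] :=
  maximal_invariant_set (f := f) (Fam := Fam) (fun S => @proj1 _ _) Fam0.
have T_all x n : ~ per f x -> (0 < n)%N -> act (g ^+ n)%g x = x -> T x.
  move=> nper n0 gx.
  apply: (Tmax (fun x => T x \/ (~ per f x /\ act (g ^+ n)%g x = act 1%g x))).
  - split; first split.
    + apply: elementary_or => //; apply: elementary_and.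
        exact/elementary_not/elementary_per.
      by apply: elementary_eq; exact: act_piecewise.
    + move=> y; rewrite (Tf y) per_act !act1.
      rewrite (act_commute _ (commute_sym (commuteX n (commute_sym gf)))).
      split=> -[]; [by left|move=> [? /act_inj]; by right|by left|].
      by move=> [? ->]; right.
    + by move=> y [/Taper|[]].
    + exists (N * n)%N; first by rewrite muln_gt0 N0.
      move=> y [/TN gy|[_]]; first by rewrite mulnC; exact: act_mulnX.
      by rewrite act1 => gy; exact: act_mulnX.
  - by move=> y; left.
  - by right; rewrite act1.
exists T; last by split=> //; exists N.
split=> // x; split=> [Thx|Tx].
  apply: (T_all _ N) => //; first by rewrite -(rev_per rev); exact: Taper.
  by apply: (@act_inj _ h); rewrite -(act_commute _ (ghX N)) TN.
apply: (T_all _ N) => //; first by rewrite (rev_per rev); exact: Taper.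
by rewrite (act_commute _ (ghX N)) TN.
Qed.

(** Take [B] maximal and let [U] be what remains outside [T]. A relation between [f] and [g] at a
    point of [U] would enlarge [B]; without one the action is free, and [swap_subregion] enlarges
    [B]. *)
Lemma swap_region T :
    [/\ elementary T, act_invariant f T & act_invariant h T] ->
    (forall x n, ~ per f x -> (0 < n)%N -> act (g ^+ n)%g x = x -> T x) ->
  exists B : R -> Prop,
    [/\ elementary B, act_invariant f B, act_invariant g B,
        forall x, B x -> ~ per f x /\ ~ B (act h x) &
        forall x, ~ per f x -> ~ B x -> ~ B (act h x) -> T x].
Proof.
move=> [Tel Tf Th] Tall.
pose Fam (S : R -> Prop) :=
  [/\ elementary S, act_invariant f S & forall x, S x -> ~ per f x] /\
  (act_invariant g S /\ forall x, S x -> ~ S (act h x)).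
have Fam0 : Fam (fun=> False) by split; [split=> //; exact: elementary_const|].
have [B [[Bel Bf Baper] [Bg Bh]] Bmax] :=
  maximal_invariant_set (f := f) (Fam := Fam) (fun S => @proj1 _ _) Fam0.
exists B; split=> // [x Bx|]; first by split; [exact: Baper|exact: Bh].
pose U x := (~ per f x /\ ~ T x) /\ (~ B x /\ ~ B (act h x)).
suff Uempty x : ~ U x.
  move=> x nper nBx nBhx; apply: contrapT => nTx; exact: (Uempty x).
move=> Ux.
have Uel : elementary U.
  apply: elementary_and; apply: elementary_and; apply: elementary_not => //.
    exact: elementary_per.
  exact: elementary_act.
have Uf : act_invariant f U.
  move=> y; rewrite /U per_act Tf Bf (rev_act rev).
  by rewrite (act_invariantV Bf (act h y)).
have Uh : act_invariant h U.
  move=> y; rewrite /U (rev_per rev) Th -act_mul (Bg y); tauto.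
have Ug : act_invariant g U by move=> y; rewrite act_mul !Uh.
have Uaper y : U y -> ~ per f y by case=> -[].
have extend C : elementary C -> act_invariant f C -> act_invariant g C ->
    (forall y, C y -> U y /\ ~ C (act h y)) -> forall y, ~ C y.
  move=> Cel Cf Cg CU y Cy.
  have [[_ [nBy _]] _] := CU y Cy; apply: nBy.
  apply: (Bmax (fun z => B z \/ C z)); [|by left|by right].
  split; first split.
  - exact: elementary_or.
  - by move=> z; rewrite Bf Cf.
  - by move=> z [/Baper|/CU[/Uaper]].
  - split=> [z|z [Bz|Cz]]; first by rewrite Bg Cg.
      move=> [|/CU[[_ [_]]]]; first exact: Bh.
      by rewrite -act_mul Bg.
    by have [[_ [_ nBhz]] nCz] := CU z Cz; case.
have Ufree y k i j : U y -> (0 < k)%N ->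
    act (g ^+ k)%g (act (f ^+ i)%g y) <> act (f ^+ j)%g y.
  move=> Uy k0 gy.
  have UfX n z : U (act (f ^+ n)%g z) <-> U z by apply: act_invariantX.
  pose C z := U z /\ act (g ^+ k * f ^+ i)%g z = act (f ^+ j)%g z.
  apply: (extend C _ _ _ _ y); last by split; rewrite ?act_mul.
  - by apply: elementary_and => //; apply: elementary_eq; exact: act_piecewise.
  - move=> z; rewrite /C (Uf z).
    have cf : commute (g ^+ k * f ^+ i)%g f.
      apply/commute_sym/commuteM; first exact/commute_sym/(gfX k 1).
      exact/commuteX/commute_refl.
    have cfj := commute_sym (commuteX j (commute_refl f)).
    rewrite (act_commute _ cf) (act_commute _ cfj).
    by split=> -[Uz]; [move=> /act_inj|move=> ->].
  - move=> z; rewrite /C (Ug z).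
    have cg : commute (g ^+ k * f ^+ i)%g g.
      apply/commute_sym/commuteM; last exact/commuteX.
      exact/commuteX/commute_refl.
    rewrite (act_commute _ cg) -(act_commute _ (commuteX j gf)).
    by split=> -[Uz]; [move=> /act_inj|move=> ->].
  (* The relation at h z reads g^k f^j z = f^i z, so g^(2k) fixes f^i z, which would then lie in
     [T]. *)
  - move=> z [Uz]; rewrite act_mul => gz; split=> // -[_].
    rewrite act_mul -!(rev_actVX rev) (act_commute _ (ghX k)).
    move=> /act_inj /(congr1 (act (f ^+ (i + j))%g)).
    rewrite -(act_commute _ (gfX k _)) {1}addnC !actD !actNXVK => gz'.
    have [[nper nT] _] := (UfX i z).2 Uz; apply: nT.
    by apply: (Tall _ (k + k)%N) => //; rewrite ?addn_gt0 ?k0 // actD gz.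
have [C [Cel Cf Cg CU [y Cy]]] := swap_subregion rev Uel Uf Uh Uaper Ufree Ux.
exact: (extend C Cel Cf Cg CU y).
Qed.

Lemma finite_order_reverser :
  exists2 k : iet R, periodic k & (k * f = f^-1 * k)%g.
Proof.
have [T HT [[N N0 TN] Tall]] := torsion_region.
have [B [Bel Bf Bg BP Brest]] := swap_region HT Tall.
have [_ _ Th] := HT.
have [tau [tau_pw tau_out tau_per tau_rev]] := orbit_reflection f.
(* As [B] is [g]-invariant, [B (act h x)] says that [x] lies in the image of [B] under [h]. *)
pose K x := if `[< per f x >] then tau x
            else if `[< B (act h x) >] then act h^-1%g x else act h x.
have K_per x : per f x -> K x = tau x by rewrite /K; case: asboolP.
have K_back x : B (act h x) -> K x = act h^-1%g x.
  move=> Bhx; have [/(_ _)/[!rev_per rev] nper _] := BP _ Bhx.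
  by rewrite /K; case: asboolP => //; case: asboolP.
have K_forth x : ~ per f x -> ~ B (act h x) -> K x = act h x.
  by move=> nper nB; rewrite /K; case: asboolP => //; case: asboolP.
have Bhh x : B (act h (act h x)) <-> B x by rewrite -act_mul.
(* [K] is an involution on the periodic points and on [B] with its image under [h]; elsewhere it is
   [h], and h^(2N) = g^N. *)
have K_order x : iter (2 * N) K x = x.
  have inv_iter : K (K x) = x -> iter (2 * N) K x = x.
    move=> KK; elim: (N) => [//|n IH].
    by rewrite mulnS /= IH.
  have [px|nper] := pselect (per f x).
    have [pt tt] := tau_per x px.
    by apply: inv_iter; rewrite K_per // K_per.
  have [Bx|nBx] := pselect (B x).
    apply: inv_iter; rewrite (K_forth x nper (BP x Bx).2) K_back ?actK //.
    exact/Bhh.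
  have [Bhx|nBhx] := pselect (B (act h x)).
    apply: inv_iter; rewrite (K_back x Bhx) K_forth ?actVK //.
    by rewrite -(rev_per rev) actVK.
  have orb n : [/\ ~ per f (iter n K x), ~ B (iter n K x),
      ~ B (act h (iter n K x)) & iter n K x = act (h ^+ n)%g x].
    elim: n => [|n [p b bh e]]; first by rewrite /= expg0 act1.
    rewrite iterS K_forth // actS -e.
    by split=> //; rewrite ?(rev_per rev) ?Bhh.
  have [_ _ _ ->] := orb (2 * N)%N.
  by rewrite expgnA expg2; apply: TN; exact: Brest.
have N2 : (0 < 2 * N)%N by rewrite muln_gt0.
have KK' : cancel K (iter (2 * N).-1 K).
  by move=> x; rewrite -iterSr prednK.
have K'K : cancel (iter (2 * N).-1 K) K.
  by move=> x; rewrite -iterS prednK.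
have K_out x : ~~ (0 <= x < 1) -> K x = x.
  move=> xout; rewrite K_per ?tau_out //; exists 1%N => //.
  by rewrite act_out.
have K_pw : piecewise_translation K.
  apply: piecewise_translation_if => //.
    exact/elementary_asbool/elementary_per.
  apply: piecewise_translation_if; try exact: act_piecewise.
  exact/elementary_asbool/elementary_act.
have [k kE] := iet_of_piecewise KK' K'K K_out K_pw.
exists k.
  exists (2 * N)%N => //; apply: act_eqP => x; rewrite act1 -[RHS]K_order.
  elim: (2 * N)%N => [|n IH]; first by rewrite expg0 act1.
  by rewrite actS IH kE.
apply: act_eqP => x; rewrite !act_mul !kE; apply: (@act_inj _ f).
rewrite actVK; have [px|nper] := pselect (per f x).
  by rewrite !K_per ?per_act // tau_rev.
have nperf : ~ per f (act f x) by rewrite per_act.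
have Bhf : B (act h (act f x)) <-> B (act h x).
  by rewrite (rev_act rev); exact: act_invariantV.
have [Bhx|nBhx] := pselect (B (act h x)).
  rewrite !K_back ?Bhf //; apply: (@act_inj _ h).
  by rewrite (rev_act rev) !actVK actK.
by rewrite !K_forth ?Bhf // (rev_act rev) actVK.
Qed.

End ConstructReverser.

Theorem corollary3 (R : realType) (f : iet R) (hf : reversible f) :
  exists p q : iet R, periodic p /\ periodic q /\ f = (p * q)%g.
Proof.
have [h hfh] := hf.
have rev : (h * f = f^-1 * h)%g by rewrite -hfh mulgVK.
have [k [n n0 kn] kf] := finite_order_reverser rev.
exists k^-1%g, (k * f)%g; split; last split; last by rewrite mulKg.
  by exists n; rewrite // expVgn kn invg1.
exists (2 * n)%N; first by rewrite muln_gt0.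
have -> : ((k * f) ^+ (2 * n) = (k ^+ 2) ^+ n)%g.
  by rewrite expgnA !expg2 {2}kf mulgA mulgK.
by rewrite expgnAC kn expg1n.
Qed.
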